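(* Let $f\colon\mathbf{R}^n\to\mathbf{R}\cup\{-\infty,+\infty\}$ be a lower-semicontinuous function and let $\bar{x}\in\mathbf{R}^n$. Then $\bar{x}$ gives a tilt-stable local minimum of $f$ if and only if $\bar{x}$ is a stable strong local minimizer of $f$.
   Context: $|\cdot|$ is the Euclidean norm on $\mathbf{R}^n$ and $\langle\cdot,\cdot\rangle$ the standard inner product. Tilt stability. $\bar{x}$ gives a tilt-stable local minimum of $f$ if $f(\bar{x})$ is finite and there exists $\epsilon>0$ such that the mapping $M\colon v\mapsto\operatorname{argmin}_{|x-\bar{x}|\leq\epsilon}\{f(x)-\langle v,x\rangle\}$ is single-valued and Lipschitz on some neighbourhood of $0$ with $M(0)=\bar{x}$. Stable strong local minimizer. $\bar{x}$, with $f(\bar{x})$ finite, is a stable strong local minimizer of $f$ if there are a constant $\kappa>0$ and a neighbourhood $U$ of $\bar{x}$ so that for each vector $v$ near the origin there is a (necessarily unique) point $x_v\in U$, with $x_0=\bar{x}$, so that, with $f_v(x):=f(x)-\langle v,x\rangle$, the inequality $f_v(x)\geq f_v(x_v)+\kappa|x-x_v|^2$ holds for each $x\in U$. *)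

(* Defs.v *)
From HB Require Import structures.
From mathcomp Require Import all_boot all_order all_algebra.
From mathcomp Require Import all_classical all_reals all_analysis.
Import Order.TTheory GRing.Theory Num.Theory.
Import numFieldNormedType.Exports.

Set Implicit Arguments.
Unset Strict Implicit.
Unset Printing Implicit Defensive.

Local Open Scope classical_set_scope.
Local Open Scope ring_scope.

Definition dotv (R : realType) (n : nat) (u v : 'rV[R]_n) : R :=
  \sum_(i < n) u 0 i * v 0 i.

(* The norm `|x| of the library on 'rV[R]_n is the max norm; it induces the
   same neighborhoods as [enorm], so [nbhs] is used unchanged below. *)
Definition enorm (R : realType) (n : nat) (u : 'rV[R]_n) : R :=
  Num.sqrt (dotv u u).

Definition argmin (R : realType) (T : Type) (A : set T) (g : T -> \bar R) :
    set T :=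
  [set x | A x /\ forall y, A y -> (g x <= g y)%E].

Definition tilt (R : realType) (n : nat) (f : 'rV[R]_n -> \bar R)
    (v : 'rV[R]_n) : 'rV[R]_n -> \bar R :=
  fun x => (f x - (dotv v x)%:E)%E.

Definition tilt_argmin (R : realType) (n : nat) (f : 'rV[R]_n -> \bar R)
    (xbar : 'rV[R]_n) (e : R) (v : 'rV[R]_n) : set 'rV[R]_n :=
  argmin [set x | enorm (x - xbar) <= e] (tilt f v).

Definition single_valued_lipschitz_on (R : realType) (n : nat)
    (V : set 'rV[R]_n) (M : 'rV[R]_n -> set 'rV[R]_n) : Prop :=
  exists m : 'rV[R]_n -> 'rV[R]_n,
    (forall v, V v -> M v = [set m v]) /\
    (exists2 L : R, 0 <= L &
       forall v w, V v -> V w -> enorm (m v - m w) <= L * enorm (v - w)).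

Definition tilt_stable_local_min (R : realType) (n : nat)
    (f : 'rV[R]_n -> \bar R) (xbar : 'rV[R]_n) : Prop :=
  f xbar \is a fin_num /\
  exists2 e : R, 0 < e &
    (exists2 V : set 'rV[R]_n, nbhs (0 : 'rV[R]_n) V &
       single_valued_lipschitz_on V (tilt_argmin f xbar e)) /\
    tilt_argmin f xbar e 0 = [set xbar].

Definition stable_strong_local_minimizer (R : realType) (n : nat)
    (f : 'rV[R]_n -> \bar R) (xbar : 'rV[R]_n) : Prop :=
  f xbar \is a fin_num /\
  exists (kappa : R) (U : set 'rV[R]_n),
    [/\ 0 < kappa, nbhs xbar U &
      exists xs : 'rV[R]_n -> 'rV[R]_n,
        xs 0 = xbar /\
        \forall v \near (0 : 'rV[R]_n),
          U (xs v) /\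
          forall x, U x ->
            (tilt f v x >=
             tilt f v (xs v) + (kappa * enorm (x - xs v) ^+ 2)%:E)%E].

(* Main.v *)
(** A tilt-stable minimizer [m v] makes [g v = - min f_v] a function with
    Lipschitz gradient [m], so [g w <= g v + <m v, w - v> + L |w - v|^2].
    Inserting this in [f x >= <w, x> - g w] at [w = v + t (x - m v)], for a small
    fixed [t > 0], gives quadratic growth of [f_v] at [m v] with modulus
    [t - L t^2].  Conversely, adding the growth inequalities of [f_v] at [x_w] and of
    [f_w] at [x_v] gives [2 kappa |x_w - x_v|^2 <= <w - v, x_w - x_v>], so
    [x_v] is Lipschitz in [v] and remains in a small ball around [xbar]. *)
Require Import Defs.
From mathcomp Require Import all_boot all_order all_algebra.
From mathcomp Require Import all_classical all_reals all_analysis.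
From mathcomp Require Import ring lra.
Import Order.TTheory GRing.Theory Num.Theory.
Import numFieldNormedType.Exports.

Set Implicit Arguments.
Unset Strict Implicit.
Unset Printing Implicit Defensive.

Local Open Scope classical_set_scope.
Local Open Scope ring_scope.

(** * The Euclidean norm and its comparison with the max norm *)

Section EuclideanNorm.
Variables (R : realType) (n : nat).
Implicit Types (u v w : 'rV[R]_n) (a : R).

Lemma dotvC u v : dotv u v = dotv v u.
Proof. by apply: eq_bigr => i _; rewrite mulrC. Qed.

Lemma dotvDl u v w : dotv (u + v) w = dotv u w + dotv v w.
Proof. by rewrite -big_split; apply: eq_bigr => i _; rewrite !mxE mulrDl. Qed.

Lemma dotvZl a u v : dotv (a *: u) v = a * dotv u v.
Proof. by rewrite /dotv mulr_sumr; apply: eq_bigr => i _; rewrite !mxE mulrA. Qed.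

Lemma dotvBl u v w : dotv (u - v) w = dotv u w - dotv v w.
Proof. by rewrite -scaleN1r dotvDl dotvZl mulN1r. Qed.

Lemma dotvBr u v w : dotv w (u - v) = dotv w u - dotv w v.
Proof. by rewrite dotvC dotvBl !(dotvC w). Qed.

Lemma dotv_ge0 u : 0 <= dotv u u.
Proof. by apply: sumr_ge0 => i _; rewrite -expr2 sqr_ge0. Qed.

Lemma enorm_ge0 u : 0 <= enorm u.
Proof. exact: sqrtr_ge0. Qed.

Lemma sqr_enorm u : enorm u ^+ 2 = dotv u u.
Proof. by rewrite sqr_sqrtr ?dotv_ge0. Qed.

Lemma enorm_distC u v : enorm (u - v) = enorm (v - u).
Proof.
apply/eqP; rewrite -(eqrXn2 (n := 2)) ?enorm_ge0 // !sqr_enorm; apply/eqP.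
by rewrite !dotvBl !dotvBr; ring.
Qed.

Lemma normr_le_enorm u : `|u| <= enorm u.
Proof.
rewrite [leLHS]mx_normrE; apply: bigmax_le => [|[i j] _ /=]; first exact: enorm_ge0.
rewrite ord1 -(ler_pXn2r (n := 2)) ?nnegrE ?enorm_ge0 // sqr_enorm real_normK ?num_real //.
by rewrite /dotv (bigD1 j) //= expr2 lerDl sumr_ge0 // => k _; rewrite -expr2 sqr_ge0.
Qed.

Lemma enorm_le_normr u : enorm u <= n.+1%:R * `|u|.
Proof.
rewrite -(ler_pXn2r (n := 2)) ?nnegrE ?enorm_ge0 ?mulr_ge0 // sqr_enorm exprMn.
(* The crude factor [n.+1] is positive even for [n = 0], so [nbhs_enorm_ball] can divide by it. *)
apply: (@le_trans _ _ (\sum_(i < n) `|u| ^+ 2)).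
  apply: ler_sum => i _; rewrite -expr2 -[leLHS]real_normK ?num_real //.
  rewrite ler_pXn2r ?nnegrE //.
  by rewrite [leRHS]mx_normrE (le_bigmax _ _ (0, i)).
rewrite sumr_const card_ord -[leLHS]mulr_natl ler_wpM2r ?exprn_ge0 //.
by rewrite -natrX ler_nat (leq_trans (leqnSn n)) // leq_pmulr.
Qed.

Lemma enorm_le0 u : enorm u <= 0 -> u = 0.
Proof.
by move=> u0; apply/eqP; rewrite -normr_le0; apply: le_trans (normr_le_enorm u) u0.
Qed.

(** Cauchy-Schwarz: expand the squared length of |v| u - |u| v, which is nonnegative, and divide by
    |u| |v|. *)
Lemma dotv_le_enormM u v : dotv u v <= enorm u * enorm v.
Proof.
have dotv0 w : dotv 0 w = 0 by rewrite -(scale0r w) dotvZl mul0r.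
have [/enorm_le0 ->|u0] := leP (enorm u) 0; first by rewrite dotv0 mulr_ge0 ?enorm_ge0.
have [/enorm_le0 ->|v0] := leP (enorm v) 0.
  by rewrite dotvC dotv0 mulr_ge0 ?enorm_ge0.
have uv0 : 0 < enorm u * enorm v by rewrite mulr_gt0.
have := dotv_ge0 (enorm v *: u - enorm u *: v).
rewrite !(dotvBl, dotvBr, dotvZl) !(dotvC _ (_ *: _)) !dotvZl -!sqr_enorm (dotvC v u).
by move=> duv; rewrite -(ler_pM2l uv0); lra.
Qed.

Lemma nbhs_normrP u (A : set 'rV[R]_n) :
  nbhs u A <-> exists2 a, 0 < a & forall w, `|u - w| < a -> A w.
Proof. exact: (@nbhs_normP R 'rV[R]_n u A). Qed.

Lemma nbhs_enorm_ball u a : 0 < a -> nbhs u [set w | enorm (w - u) <= a].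
Proof.
move=> a0; apply/nbhs_normrP; exists (a / n.+1%:R); first by rewrite /= divr_gt0.
move=> w /= uw; apply: le_trans (enorm_le_normr _) _.
by rewrite -ler_pdivlMl // mulrC distrC ltW.
Qed.

End EuclideanNorm.

(** * The two implications *)

Section TiltStability.
Variables (R : realType) (n : nat) (f : 'rV[R]_n -> \bar R) (xbar : 'rV[R]_n).

Lemma tilt_fin (v x : 'rV[R]_n) (a : R) :
  f x = a%:E -> tilt f v x = (a - dotv v x)%:E.
Proof. by rewrite /tilt => ->. Qed.

Lemma tilt0 : tilt f 0 = f.
Proof.
apply/funext => x; rewrite /tilt -(scale0r x) dotvZl mul0r.
by rewrite oppe0 adde0.
Qed.

(** The first inequality keeps [f x] away from [-oo], the second from [+oo]. With [y = xbar] this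
    makes [f] real at the minimizers of its tilts. *)
Lemma fin_num_tilt_le (v x y : 'rV[R]_n) :
    f y \is a fin_num -> (f y <= f x)%E ->
    (tilt f v x <= tilt f v y)%E -> f x \is a fin_num.
Proof. by rewrite /tilt; case: (f x) => [a||]; case: (f y). Qed.

Lemma tilt_stable_strong :
  tilt_stable_local_min f xbar -> stable_strong_local_minimizer f xbar.
Proof.
move=> [fin_xbar [e e0 [[V V0 [m [Mm [L L0 mLip]]]] M0]]].
split=> //.
pose B := [set x | enorm (x - xbar) <= e].
have fB x : B x -> (f xbar <= f x)%E.
  have : tilt_argmin f xbar e 0 xbar by rewrite M0.
  by rewrite /tilt_argmin /argmin tilt0 => -[_]; apply.
have mP v : V v -> B (m v) /\ forall y, B y -> (tilt f v (m v) <= tilt f v y)%E.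
  by move=> Vv; have : tilt_argmin f xbar e v (m v) by rewrite Mm.
have Bxbar : B xbar.
  by have [] : tilt_argmin f xbar e 0 xbar by rewrite M0.
have fm v : V v -> f (m v) = (fine (f (m v)))%:E.
  move=> Vv; have [Bm mmin] := mP v Vv.
  by rewrite fineK // (fin_num_tilt_le fin_xbar (fB _ Bm) (mmin _ Bxbar)).
have /nbhs_normrP[r /= r0 rV] := V0.
(* The first bound gives L t < 1/2, so the modulus t - L t^2 is positive. The second gives 2 e t <=
   r / 2, so [w] below stays in [V] when |v| < r / 2. *)
pose t := Num.min (2 * (L + 1))^-1 (r / (4 * e)).
have L1 : 0 < 2 * (L + 1) by lra.
have t0 : 0 < t by rewrite lt_min invr_gt0 L1 divr_gt0 // mulr_gt0.
have tL : t * (2 * (L + 1)) <= 1.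
  by rewrite -ler_pdivlMr // div1r ge_min lexx.
have te : t * (4 * e) <= r by rewrite -ler_pdivlMr ?mulr_gt0 // ge_min lexx orbT.
exists (t - L * t ^+ 2), B; split.
- by nra.
- exact: nbhs_enorm_ball.
exists m; split.
  have : tilt_argmin f xbar e 0 = [set m 0] by rewrite Mm //; apply: nbhs_singleton.
  by rewrite M0 => /seteqP[/(_ xbar erefl)].
have : \forall v \near (0 : 'rV[R]_n), `|v| < r / 2.
  apply/nbhs_normrP; exists (r / 2); first by rewrite /= divr_gt0.
  by move=> v /=; rewrite sub0r normrN.
apply: filterS => v vr.
have Vv : V v by apply: rV; rewrite /= sub0r normrN; apply: lt_trans vr _; lra.
have [Bm mmin] := mP v Vv; split=> // x Bx.
pose w := v + t *: (x - m v).
have Vw : V w.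
  apply: rV; rewrite /= sub0r normrN; apply: le_lt_trans (ler_normD _ _) _.
  rewrite normrZ (gtr0_norm t0).
  have : `|x - m v| <= 2 * e.
    have -> : x - m v = (x - xbar) - (m v - xbar) by rewrite opprB addrA subrK.
    apply: le_trans (ler_normB _ _) _.
    have := le_trans (normr_le_enorm _) Bx; have := le_trans (normr_le_enorm _) Bm.
    lra.
  by move=> /(ler_wpM2l (ltW t0)); lra.
have [Bmw mwmin] := mP w Vw.
(* The sum of these two inequalities is f_v x >= f_v (m v) + <w - v, x - m w>. Splitting x - m w at
   [m v] yields the terms bounded in [dx] and [dw]. *)
have lew := mwmin x Bx; have lev := mmin (m w) Bmw; move: lew lev.
rewrite (tilt_fin v (fm _ Vv)) (tilt_fin v (fm _ Vw)) (tilt_fin w (fm _ Vw)).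
have fx := fB x Bx; move: fx; rewrite -(fineK fin_xbar) /tilt.
(* At [+oo] the growth inequality is trivial; [-oo] contradicts [f xbar <= f x]. *)
case: (f x) => [a _|_ _ _|//]; last by rewrite /= leey.
rewrite -!EFinB -EFinD !lee_fin.
have dw : dotv (w - v) (m w - m v) <= L * t ^+ 2 * enorm (x - m v) ^+ 2.
  apply: le_trans (dotv_le_enormM _ _) _.
  have -> : w - v = t *: (x - m v) by rewrite /w addrC addKr.
  have -> : L * t ^+ 2 * enorm (x - m v) ^+ 2
            = enorm (t *: (x - m v)) * (L * enorm (t *: (x - m v))).
    rewrite [RHS]mulrCA -expr2 !sqr_enorm dotvZl (dotvC _ (_ *: _)) dotvZl.
    by ring.
  rewrite ler_wpM2l ?enorm_ge0 //; apply: le_trans (mLip _ _ Vw Vv) _.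
  by rewrite /w addrAC subrr add0r.
have dx : dotv (w - v) (x - m v) = t * enorm (x - m v) ^+ 2.
  by rewrite /w addrAC subrr add0r dotvZl sqr_enorm.
move: dw dx; rewrite !dotvBl !dotvBr; lra.
Qed.

Lemma strong_tilt_stable :
  stable_strong_local_minimizer f xbar -> tilt_stable_local_min f xbar.
Proof.
move=> [fin_xbar [k [U [k0 Uxbar [xs [xs0 xsP]]]]]]; split=> //.
have [Ux growth0] := nbhs_singleton xsP.
have fU x : U x -> (f xbar <= f x)%E.
  move=> /growth0; rewrite xs0 tilt0; apply: le_trans.
  by rewrite leeDl // lee_fin mulr_ge0 ?exprn_ge0 ?enorm_ge0 ?ltW.
rewrite xs0 in Ux.
have /nbhs_normrP[r /= r0 rU] := Uxbar.
(* Since [xs] has Lipschitz constant 1 / (2 k) on [V], the bound on |v| keeps [xs v] within r / 2 of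
   [xbar]. The closed ball of that radius lies in [U]. *)
pose V := [set v | (U (xs v) /\ forall x, U x ->
   (tilt f v (xs v) + (k * enorm (x - xs v) ^+ 2)%:E <= tilt f v x)%E) /\
   enorm (v - 0) <= 2 * k * (r / 2)].
have V0 : nbhs (0 : 'rV[R]_n) V.
  by apply: filterI xsP _; apply: nbhs_enorm_ball; nra.
have fxs v : V v -> f (xs v) = (fine (f (xs v)))%:E.
  move=> [[Uxs growth] _]; rewrite fineK //.
  apply: (fin_num_tilt_le fin_xbar (fU _ Uxs) (le_trans _ (growth _ Ux))).
  by rewrite leeDl // lee_fin mulr_ge0 ?exprn_ge0 ?enorm_ge0 ?ltW.
have xsLip v w : V v -> V w -> enorm (xs v - xs w) <= (2 * k)^-1 * enorm (v - w).
  move=> Vv Vw; have [[Uv growv] _] := Vv; have [[Uw groww] _] := Vw.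
  have := growv _ Uw; have := groww _ Uv.
  rewrite !(tilt_fin _ (fxs _ Vv)) !(tilt_fin _ (fxs _ Vw)) -!EFinD !lee_fin.
  rewrite (enorm_distC (xs w)) => gw gv.
  have := dotv_le_enormM (v - w) (xs v - xs w); rewrite dotvBl !dotvBr => dle.
  rewrite ler_pdivlMl ?mulr_gt0 //.
  have [d0|d0] := leP (enorm (xs v - xs w)) 0.
    by apply: le_trans (enorm_ge0 _); rewrite pmulr_rle0 // mulr_gt0.
  by rewrite -(ler_pM2r d0); lra.
have BU x : enorm (x - xbar) <= r / 2 -> U x.
  move=> xr; apply: rU; rewrite /= distrC.
  by apply: le_lt_trans (normr_le_enorm _) _; apply: le_lt_trans xr _; lra.
have Mxs v : V v -> tilt_argmin f xbar (r / 2) v = [set xs v].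
  move=> Vv; have [[Uv growv] vr] := Vv.
  have Bv : enorm (xs v - xbar) <= r / 2.
    rewrite -xs0; apply: le_trans (xsLip _ _ Vv (nbhs_singleton V0)) _.
    by rewrite ler_pdivrMl ?mulr_gt0.
  (* Growth at a minimizer [x], compared with its minimality against [xs v], forces k |x - xs v|^2
     <= 0. *)
  apply/seteqP; split=> [x [Bx xmin]|_ ->].
    have := le_trans (growv x (BU _ Bx)) (xmin _ Bv).
    rewrite (tilt_fin v (fxs _ Vv)) -EFinD lee_fin gerDl pmulr_rle0 //.
    rewrite sqr_enorm => d0; apply/eqP; rewrite -subr_eq0; apply/eqP/enorm_le0.
    by rewrite /enorm ler0_sqrtr.
  split=> // y /BU Uy; apply: le_trans (growv y Uy).
  by rewrite leeDl // lee_fin mulr_ge0 ?exprn_ge0 ?enorm_ge0 ?ltW.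
exists (r / 2); first by rewrite divr_gt0.
split; last by rewrite Mxs ?xs0 //; apply: nbhs_singleton.
exists V => //; exists xs; split=> //.
by exists (2 * k)^-1; rewrite // invr_ge0 mulr_ge0 // ltW.
Qed.

End TiltStability.

Theorem corollary3p2 (R : realType) (n : nat) (f : 'rV[R]_n -> \bar R)
    (xbar : 'rV[R]_n) (hf : lower_semicontinuous f) :
  tilt_stable_local_min f xbar <-> stable_strong_local_minimizer f xbar.
Proof.
by split; [exact: tilt_stable_strong | exact: strong_tilt_stable].
Qed.
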